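(* Let $n\in\mathbb{Z}^+$ with $n\geq 2$. Let $R_3$, $R_4$, $R_6$ denote the (infinite) graphs of the regular tilings of the plane by triangles, squares, and hexagons, respectively. Then $\chi_{n} (R_3) = 3$, $\chi_{n} (R_4) = 2$, and $\chi_{n} (R_6) = 2$.
   Context: The graph of a tiling has the tile corners as vertices and tile edges as edges (so $R_3$ is 6-regular, $R_4$ is 4-regular, $R_6$ is 3-regular). For a graph $G=(V,E)$, a $\mathbb{Z}$-labeling is a map $\ell:V\to\mathbb{Z}$; its order is the size of its range; it is proper if adjacent vertices get different labels. $N[v]$ is the closed neighborhood of $v$. A closed coloring with nonzero remainders mod $n$ is a labeling with $\sum_{w\in N[v]}\ell(w)\not\equiv 0 \pmod n$ for all $v\in V$. $\chi_n(G)$ denotes the minimum order of a proper closed coloring with nonzero remainders mod $n$ of $G$. *)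

(* Defs.v *)
From HB Require Import structures.
From mathcomp Require Import all_boot all_order all_algebra.
From mathcomp Require Import mathcomp_extra boolp classical_sets functions.
From mathcomp Require Import cardinality fsbigop reals.

Set Implicit Arguments.
Unset Strict Implicit.
Unset Printing Implicit Defensive.
Import Order.TTheory GRing.Theory Num.Theory.
Local Open Scope classical_set_scope.
Local Open Scope ring_scope.

Record graph := Graph {
  vertex :> choiceType;
  adj : vertex -> vertex -> Prop;
  adj_sym : forall v w, adj v w -> adj w v;
  adj_irr : forall v, ~ adj v v }.

Section Labelings.
Variable G : graph.
Implicit Types (l : G -> int) (n k : nat).

Definition closed_nbhd (v : G) : set G := [set w | w = v \/ adj v w].

Definition proper_labeling l := forall v w : G, adj v w -> l v != l w.

(* The sum is the finitely supported one of [fsbigop], which is the ordinary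
   sum as soon as the closed neighborhoods are finite (locally finite graph). *)
Definition closed_coloring n l :=
  forall v : G, (\sum_(w \in closed_nbhd v) l w != 0 %[mod n%:Z])%Z.

Definition has_order l k := (range l #= `I_k)%card.

Definition coloring_orders n : set nat :=
  [set k | exists l, [/\ proper_labeling l, closed_coloring n l
                       & has_order l k]].

(* The value is the default 0 when no such labeling has finite order. On a
   graph with a vertex, no labeling has order 0, so that [chi n = m] with
   [0 < m] does assert that the minimum is attained and equal to [m]. *)
Definition chi n : nat :=
  xget 0%N [set m | coloring_orders n m /\
                    forall k, coloring_orders n k -> (m <= k)%N].

End Labelings.

Section Tilings.
Variable R : realType.

Definition plane : choiceType := (R * R)%type.

(* A polygonal tile is given by the cyclic sequence of its corners. *)
Definition tiling := set (seq plane).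

Definition corner (T : tiling) : set plane :=
  [set x | exists2 t, T t & x \in t].

Definition tile_edge (T : tiling) (x y : plane) :=
  exists2 t, T t & (x \in t /\ y = next t x) \/ (y \in t /\ x = next t y).

Section TilingGraph.
Variable T : tiling.

(* [!=] only excludes the edges of degenerate one-corner tiles. *)
Definition tiling_adj (v w : set_type (corner T)) :=
  val v != val w /\ tile_edge T (val v) (val w).

Lemma tiling_adj_sym v w : tiling_adj v w -> tiling_adj w v.
Proof.
move=> [vw [t Tt e]]; split; first by rewrite eq_sym.
by exists t => //; case: e; [right | left].
Qed.

Lemma tiling_adj_irr v : ~ tiling_adj v v.
Proof. by case; rewrite eqxx. Qed.

Definition tiling_graph : graph :=
  @Graph (set_type (corner T)) tiling_adj tiling_adj_sym tiling_adj_irr.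

End TilingGraph.

Definition square_pt (i j : int) : plane := (i%:~R, j%:~R).

(* The point i u + j v, with the unit vectors u = (1, 0) and
   v = (1/2, sqrt 3 / 2) at an angle of 60 degrees. *)
Definition triangular_pt (i j : int) : plane :=
  (i%:~R + j%:~R / 2, j%:~R * (Num.sqrt 3 / 2)).

(* All tiles below are regular polygons of side 1; each edge-to-edge tiling of
   the plane by congruent regular polygons is similar to one of the three. *)

Definition triangle_tiling : tiling :=
  [set t | exists i j : int,
     t = [:: triangular_pt i j; triangular_pt (i + 1) j;
             triangular_pt i (j + 1)] \/
     t = [:: triangular_pt (i + 1) j; triangular_pt (i + 1) (j + 1);
             triangular_pt i (j + 1)]].

Definition square_tiling : tiling :=
  [set t | exists i j : int,
     t = [:: square_pt i j; square_pt (i + 1) j;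
             square_pt (i + 1) (j + 1); square_pt i (j + 1)]].

(* The hexagon centers are the triangular lattice points i u + j v with
   i = j mod 3, and the corners of a hexagon are the six lattice points
   at distance 1 from its center, listed counterclockwise. *)
Definition hexagon_tiling : tiling :=
  [set t | exists2 ij : int * int, (ij.1 = ij.2 %[mod 3])%Z &
     let: (i, j) := ij in
     t = [:: triangular_pt (i + 1) j; triangular_pt i (j + 1);
             triangular_pt (i - 1) (j + 1); triangular_pt (i - 1) j;
             triangular_pt i (j - 1); triangular_pt (i + 1) (j - 1)]].

Definition R3 : graph := tiling_graph triangle_tiling.
Definition R4 : graph := tiling_graph square_tiling.
Definition R6 : graph := tiling_graph hexagon_tiling.

End Tilings.

(* Main.v *)
(** A tile edge forces two labels, a triangle three. For the upper bounds, color
    the lattice point [(i, j)] by [i - j mod 3] (triangles, and hexagons, whose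
    centers form the color class 0) or by [i + j mod 2] (squares), and label the
    color classes. Labels distinct but all congruent to 1 mod n make each closed
    sum congruent to 7 for triangles and 5 for squares, which is nonzero unless
    n is that prime; then other labels work. For hexagons, the labels 1 and 0
    give the sums 1 and 3, which works unless n = 3, where 1 and 4 do. *)
Require Import Defs.
From mathcomp Require Import all_boot reals.
From HB Require Import structures.
From mathcomp Require Import all_order all_algebra zify ring.
From mathcomp Require Import boolp classical_sets.
From mathcomp Require Import cardinality fsbigop finmap.

Set Implicit Arguments.
Unset Strict Implicit.
Unset Printing Implicit Defensive.
Import Order.TTheory GRing.Theory Num.Theory.
Local Open Scope classical_set_scope.

(** * Orders of labelings and the lower bound from cliques *)

Lemma card_set_seq (T : choiceType) (s : seq T) :
  uniq s -> ([set` s] #= `I_(size s))%card.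
Proof.
move=> us; have -> : [set` s] = [set` [fset x in s]%fset].
  by apply/seteqP; split=> x /=; rewrite !inE.
by apply/card_eq_fsetP; rewrite card_fseq undup_id.
Qed.

Lemma uniq_map_inj_in (T1 T2 : eqType) (f : T1 -> T2) (s : seq T1) :
  uniq (map f s) -> {in s &, injective f}.
Proof.
elim: s => //= a s IHs /andP[fa us] x y; rewrite !inE.
move=> /predU1P[->|xs] /predU1P[->|ys] // fxy; last exact: IHs.
  by case/mapP: fa; exists y.
by case/mapP: fa; exists x.
Qed.

Section Orders.
Variable G : graph.

(** A proper labeling is injective on a clique, so the labels of [s] are [size s] distinct elements
    of the range. *)
Lemma leq_order_clique (l : G -> int) (k : nat) (s : seq G) :
  proper_labeling l -> has_order l k ->
  pairwise (fun v w => `[< adj v w >]) s -> size s <= k.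
Proof.
move=> pl ok sc; have us : uniq (map l s).
  rewrite uniq_pairwise pairwise_map; apply: sub_pairwise sc => v w /asboolP.
  exact: pl.
rewrite -(size_map l) -card_le_II.
apply: (@card_le_trans _ _ _ [set` map l s]).
  by have /card_eqPle[] := card_set_seq us.
apply: (@card_le_trans _ _ _ (range l)); last by have /card_eqPle[] := ok.
by apply: subset_card_le => _ /= /mapP[v _ ->]; exists v.
Qed.

Lemma chi_eq (n m : nat) :
  coloring_orders G n m -> (forall k, coloring_orders G n k -> m <= k) ->
  chi G n = m.
Proof.
move=> cm lem; apply: xget_unique; first by split.
by move=> k [ck lek]; apply/eqP; rewrite eqn_leq lek ?lem.
Qed.

End Orders.

(** * Periodic tilings: reduction to finitely many classes *)

Local Open Scope ring_scope.

(* The tiles are the translates of the prototiles in [S] by the lattice vectors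
   whose class under [kappa] satisfies [B]. Everything then depends only on the
   classes, which reduces the combinatorics of the plane to a finite
   computation. *)
Section PeriodicTiling.
Variables (R : realType) (L A : zmodType).
Variables (pt : L -> plane R) (kappa : {additive L -> A}).
Variables (B : pred A) (S : seq (seq L)).
Hypothesis pt_inj : injective pt.
Hypothesis S_uniq : all uniq S.

Definition periodic_tiling : tiling R :=
  [set t | exists2 c, B (kappa c) &
     exists2 s, s \in S & t = [seq pt (c + o) | o <- s]].

(* The directed sides of the prototiles, in both directions. *)
Definition sides : seq (L * L) :=
  flatten [seq [seq (o, next s o) | o <- s] ++ [seq (next s o, o) | o <- s]
          | s <- S].

(** A point of class [a] is the copy of the corner [o] exactly under a translation of class
    [a - kappa o]. *)
Definition vertex_class (a : A) : bool :=
  has (has (fun o => B (a - kappa o))) S.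

(** Displacements from a vertex of class [a] to its neighbors. An edge shared by two tiles arises
    twice; [undup] keeps it from being counted twice in closed sums. *)
Definition steps (a : A) : seq L :=
  undup [seq e.2 - e.1 | e <- sides & B (a - kappa e.1) && (e.1 != e.2)].

Let G := tiling_graph periodic_tiling.

Lemma periodic_cornerP (p : L) :
  corner periodic_tiling (pt p) <-> vertex_class (kappa p).
Proof.
split=> [[t [c Bc [s sS ->]] /mapP[o os /pt_inj ->]]|].
  by apply/hasP; exists s => //; apply/hasP; exists o; rewrite // raddfD addrK.
move=> /hasP[s sS /hasP[o os Bo]].
exists [seq pt (p - o + o') | o' <- s].
  by exists (p - o); [rewrite raddfB | exists s].
by apply/mapP; exists o; rewrite // subrK.
Qed.

Lemma mem_sides (e : L * L) :
  reflect (exists2 s, s \in S & (e.1 \in s /\ e.2 = next s e.1) \/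
                                (e.2 \in s /\ e.1 = next s e.2))
          (e \in sides).
Proof.
case: e => a b; apply: (iffP flattenP) => /=.
  move=> [_ /mapP[s sS ->]]; rewrite mem_cat => /orP[] /mapP[o os [-> ->]];
  exists s => //; by [left | right].
move=> [s sS h]; exists ([seq (o, next s o) | o <- s] ++
                         [seq (next s o, o) | o <- s]).
  by apply/mapP; exists s.
rewrite mem_cat; apply/orP; case: h => -[os ->]; [left|right].
  by apply/mapP; exists a.
by apply/mapP; exists b.
Qed.

Lemma periodic_edgeP (p q : L) :
  (pt p != pt q /\ tile_edge periodic_tiling (pt p) (pt q)) <->
  q - p \in steps (kappa p).
Proof.
(* Translation followed by [pt] is injective, so [next] can be pulled back from a tile to its
   prototile. *)
have edge c s x y : s \in S ->
    (pt x \in [seq pt (c + o) | o <- s] /\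
     pt y = next [seq pt (c + o) | o <- s] (pt x)) <->
    (x - c \in s /\ y - c = next s (x - c)).
  move=> sS; have inj : injective (fun o => pt (c + o)).
    by move=> o o' /pt_inj /addrI.
  have xE z : pt z = (fun o => pt (c + o)) (z - c) by rewrite /= addrC subrK.
  have us : uniq s by apply: (allP S_uniq).
  rewrite (xE x) (mem_map inj) (next_map inj us) (xE y).
  by split=> -[? h]; split=> //; [apply: inj | rewrite h].
rewrite mem_undup (inj_eq pt_inj); split.
  move=> [pq [_ [c Bc [s sS ->]] h]]; apply/mapP; exists (p - c, q - c).
    rewrite mem_filter /= (inj_eq (addIr _)) pq andbT -raddfB opprB addrC.
    rewrite subrK Bc /=; apply/mem_sides; exists s => //=.
    by case: h => /(edge c s _ _ sS) h; [left|right].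
  by rewrite /= opprB subrKA.
move=> /mapP[[a b]]; rewrite mem_filter /= => /andP[/andP[Ba ab]].
move=> /mem_sides[s sS /= h] qp.
(* Translation by [p - a] carries the side [(a, b)] to [(p, q)]. *)
have aE : p - (p - a) = a by rewrite opprB addrC subrK.
have bE : q - (p - a) = b by rewrite opprB addrCA addrC qp subrK.
split; first by apply: contraNneq ab => pq; rewrite -aE -bE pq.
exists [seq pt (p - a + o) | o <- s].
  by exists (p - a); [rewrite raddfB | exists s].
by case: h => h; [left|right]; apply/(edge _ _ _ _ sS); rewrite aE bE.
Qed.

(** Inverse of [pt] on its image. The default 0 is harmless, since every vertex is a lattice
    point. *)
Let coords (x : plane R) : L := xget 0 [set p | pt p = x].

Lemma ptK : cancel pt coords.
Proof. by move=> p; apply: xget_unique => // q /= /pt_inj. Qed.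

Lemma vertex_coords (v : G) : pt (coords (val v)) = val v.
Proof.
have [t [c _ [s _ ->]] /mapP[o _ ->]] := set_mem (valP v).
by rewrite ptK.
Qed.

Lemma vertex_classP (v : G) : vertex_class (kappa (coords (val v))).
Proof.
by apply/periodic_cornerP; rewrite vertex_coords; exact: set_mem (valP v).
Qed.

Lemma closed_nbhd_steps (v : G) :
  val @` closed_nbhd v =
  [set` [seq pt (coords (val v) + d)
        | d <- 0 :: steps (kappa (coords (val v)))]].
Proof.
set p := coords (val v); have pE := vertex_coords v.
apply/seteqP; split=> x.
  move=> [w vw <-]; apply/mapP; exists (coords (val w) - p).
    rewrite inE; case: vw => [->|vw]; first by rewrite subrr eqxx.
    by apply/orP; right; apply/periodic_edgeP; rewrite pE vertex_coords.
  by rewrite addrC subrK vertex_coords.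
move=> /mapP[d + ->]; rewrite inE => /predU1P[->|ds].
  by exists v; [left | rewrite addr0 pE].
have /periodic_edgeP : (p + d) - p \in steps (kappa p) by rewrite addrC addKr.
rewrite pE => -[ne e].
have cw : corner periodic_tiling (pt (p + d)).
  by case: e => t Tt [] [h1 h2]; exists t => //; rewrite h2 mem_next.
exists (SigSub (mem_set cw)) => //.
by right.
Qed.

(** Pull [lam] back along [kappa]. No step preserves the class, so this labeling is proper; closed
    sums depend only on the class; and the labels used are those of the classes of [c], which are
    [size c] in number. Since [c] is also a clique, fewer labels cannot suffice. *)
Lemma chi_periodic (n : nat) (c : seq L) (lam : A -> int) :
  (forall a, vertex_class a = (a \in map kappa c)) ->
  pairwise (fun p q => q - p \in steps (kappa p)) c ->
  all (fun a => 0 \notin map kappa (steps a)) (map kappa c) ->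
  uniq (map lam (map kappa c)) ->
  {in map kappa c, forall a,
    (\sum_(d <- 0%R :: steps a) lam (a + kappa d) != 0 %[mod n%:Z])%Z} ->
  chi G n = size c.
Proof.
move=> Vc cc st0 lam_uniq sum0; apply: chi_eq.
  pose l (v : G) := lam (kappa (coords (val v))); exists l; split.
  - move=> v w vw; have Vv := vertex_classP v; have Vw := vertex_classP w.
    rewrite !Vc in Vv Vw; apply/eqP => /(uniq_map_inj_in lam_uniq Vv Vw) E.
    have /(allP st0)/negP := Vv; apply.
    apply/mapP; exists (coords (val w) - coords (val v)).
      by apply/periodic_edgeP; rewrite !vertex_coords.
    by rewrite raddfB E subrr.
  - move=> v; pose f x := lam (kappa (coords x)).
    have -> : \sum_(w \in closed_nbhd v) l w =
              \sum_(x \in val @` closed_nbhd v) f x.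
      by rewrite fsbig_image // => x y _ _; apply: val_inj.
    (* [fsbig_seq] asks for a list without repetition: 0 is no step because degenerate sides were
       filtered out. *)
    rewrite closed_nbhd_steps -fsbig_seq; last first.
      rewrite map_inj_uniq; last by move=> x y /pt_inj /addrI.
      rewrite cons_uniq undup_uniq andbT mem_undup.
      apply/negP => /mapP[[a b]]; rewrite mem_filter /= => /andP[/andP[_ ab] _].
      by move=> /eqP; rewrite eq_sym subr_eq0 eq_sym (negPf ab).
    rewrite big_map; under eq_bigr => d _ do rewrite /f ptK raddfD.
    by apply: sum0; have := vertex_classP v; rewrite Vc.
  - rewrite /has_order; have -> : range l = [set` map lam (map kappa c)].
      apply/seteqP; split=> x.
        move=> [v _ <-]; apply/mapP; exists (kappa (coords (val v))) => //.
        by have := vertex_classP v; rewrite Vc.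
      move=> /mapP[_ /mapP[p pc ->] ->].
      have cp : corner periodic_tiling (pt p).
        by apply/periodic_cornerP; rewrite Vc; apply: map_f.
      by exists (SigSub (mem_set cp)); rewrite // /l /= ptK.
    by have := card_set_seq lam_uniq; rewrite !size_map.
move=> k [l [pl _ ok]].
have cornerc p : p \in c -> pt p \in corner periodic_tiling.
  by move=> pc; apply/mem_set/periodic_cornerP; rewrite Vc; apply: map_f.
(* The clique is lifted to the subtype of corners; [vsE] shows that no point is lost. *)
pose vs : seq G := pmap insub (map pt c).
have vsE : map val vs = map pt c.
  rewrite pmap_filter; last by move=> x; rewrite insubK.
  apply/all_filterP/allP => x /mapP[p pc ->].
  by rewrite isSome_insub; exact: cornerc.
rewrite -(size_map pt) -vsE size_map; apply: leq_order_clique pl ok _.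
have : pairwise (fun x y => `[< x != y /\ tile_edge periodic_tiling x y >])
                (map val vs).
  rewrite vsE pairwise_map; apply: sub_pairwise cc => p q pq.
  by apply/asboolP/periodic_edgeP.
by rewrite pairwise_map; apply: sub_pairwise => v w /asboolP h; apply/asboolP.
Qed.

End PeriodicTiling.

(** * The three regular tilings as periodic tilings *)

Definition lattice_class (m : nat) (s : int) (p : int * int) : 'Z_m :=
  (p.1 + s * p.2)%:~R.

Lemma lattice_class_is_zmod_morphism m s : zmod_morphism (lattice_class m s).
Proof.
move=> p q; rewrite /lattice_class -intrB; congr (_%:~R).
by case: p q => [a b] [c d] /=; ring.
Qed.

HB.instance Definition _ m s :=
  GRing.isZmodMorphism.Build (int * int)%type 'Z_m (lattice_class m s)
    (lattice_class_is_zmod_morphism m s).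

Lemma triangular_pt_inj (R : realType) :
  injective (fun p : int * int => triangular_pt R p.1 p.2).
Proof.
move=> [i j] [i' j'] [/= + /mulIf].
have s0 : Num.sqrt 3 / 2 != 0 :> R.
  by rewrite mulf_neq0 ?invr_eq0 ?sqrtr_eq0 -?ltNge ?ltr0n ?pnatr_eq0.
by move=> + /(_ s0) /intr_inj jj; rewrite jj => /addIr /intr_inj ->.
Qed.

Lemma square_pt_inj (R : realType) :
  injective (fun p : int * int => square_pt R p.1 p.2).
Proof. by move=> [i j] [i' j'] [/intr_inj -> /intr_inj ->]. Qed.

Lemma triangle_tilingE (R : realType) :
  @triangle_tiling R =
  periodic_tiling (fun p : int * int => triangular_pt R p.1 p.2)
    (lattice_class 3 (-1)) xpredT
    [:: [:: (0, 0); (1, 0); (0, 1)]; [:: (1, 0); (1, 1); (0, 1)]].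
Proof.
apply/seteqP; split=> t.
  move=> [i [j [] ->]]; exists (i, j) => //.
    by exists [:: (0, 0); (1, 0); (0, 1)]; rewrite //= !addr0.
  by exists [:: (1, 0); (1, 1); (0, 1)]; rewrite //= !addr0.
move=> [[i j] _ [s + ->]]; rewrite !inE => /orP[] /eqP ->; exists i, j;
  rewrite /= !addr0; by [left | right].
Qed.

Lemma square_tilingE (R : realType) :
  @square_tiling R =
  periodic_tiling (fun p : int * int => square_pt R p.1 p.2)
    (lattice_class 2 1) xpredT [:: [:: (0, 0); (1, 0); (1, 1); (0, 1)]].
Proof.
apply/seteqP; split=> t.
  move=> [i [j ->]]; exists (i, j) => //; eexists; first exact: mem_head.
  by rewrite /= !addr0.
move=> [[i j] _ [s + ->]]; rewrite !inE => /eqP ->; exists i, j.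
by rewrite /= !addr0.
Qed.

Lemma lattice_class_eq0 (i j : int) :
  (lattice_class 3 (-1) (i, j) == 0) = (i == j %[mod 3])%Z.
Proof.
by rewrite eqz_mod_dvd /lattice_class /= mulN1r (dvdz_pcharf (@pchar_Fp 3 isT)).
Qed.

Lemma hexagon_tilingE (R : realType) :
  @hexagon_tiling R =
  periodic_tiling (fun p : int * int => triangular_pt R p.1 p.2)
    (lattice_class 3 (-1)) (pred1 0)
    [:: [:: (1, 0); (0, 1); (-1, 1); (-1, 0); (0, -1); (1, -1)]].
Proof.
apply/seteqP; split=> t.
  move=> [[i j] /= /eqP ij ->]; exists (i, j).
    by rewrite /= lattice_class_eq0.
  by eexists; [exact: mem_head | rewrite /= !addr0].
move=> [[i j] /= + [s + ->]]; rewrite lattice_class_eq0 !inE => /eqP ij /eqP ->.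
by exists (i, j); rewrite //= !addr0.
Qed.

(** * Explicit labels and the three values *)

(** Modulo [n] the number [x] is [p], and the only divisors of a prime [p] are 1 and [p]. *)
Lemma neq0_modz_prime (p n : nat) (x q : int) :
  prime p -> (2 <= n)%N -> n != p -> x = p%:Z + q * n%:Z ->
  (x != 0 %[mod n%:Z])%Z.
Proof.
move=> /primeP[_ pp] n2 np ->; rewrite addrC modzMDl eqz_mod_dvd subr0.
have -> : (n%:Z %| p%:Z)%Z = (n %| p)%N by [].
by apply: contraL n2 => /pp; rewrite (negPf np) orbF => /eqP ->.
Qed.

Lemma chi_triangle (R : realType) (n : nat) : (2 <= n)%N -> chi (R3 R) n = 3%N.
Proof.
move=> n2; rewrite /R3 triangle_tilingE.
(* Each vertex has three neighbors in each of the other two classes. The closed sums are 22, 24, 10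
   for [n = 7], and otherwise [7 + 9 n], [7 + 7 n], [7 + 5 n], whence the quotients 9, 7, 5
   below. *)
pose b : seq int := if n == 7%N then [:: 1; 0; 7]
                    else [:: 1; 1 + n%:Z; 1 + 2 * n%:Z].
rewrite (@chi_periodic _ _ _ _ _ _ _ (@triangular_pt_inj R) _ n
  [:: (0, 0); (1, 0); (0, 1)] (fun a : 'Z_3 => nth 0 b a)) //.
- by case=> -[|[|[|]]].
(* Splitting the residues off from the labels lets them be computed while [n] stays abstract; the
   sums below are treated likewise. *)
- rewrite -[X in map X]/(nth 0 b \o val) map_comp; set s := map val _.
  vm_compute in s; rewrite /s /= /b.
  by case: eqP => [//|_]; rewrite /= !inE; lia.
- move=> a /mapP[p]; rewrite !inE => /or3P[] /eqP -> ->;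
  rewrite -(big_map (fun d => val _) xpredT (nth 0 b)); set s := map _ _;
  vm_compute in s; rewrite /s !big_cons big_nil /= /b;
  (have [->//|n7] := eqVneq n 7%N);
  [ apply: (@neq0_modz_prime 7 n _ 9) => // |
    apply: (@neq0_modz_prime 7 n _ 7) => // |
    apply: (@neq0_modz_prime 7 n _ 5) => // ]; ring.
Qed.

Lemma chi_square (R : realType) (n : nat) : (2 <= n)%N -> chi (R4 R) n = 2%N.
Proof.
move=> n2; rewrite /R4 square_tilingE.
(* All four neighbors lie in the other class: the sums are 1 and 4 for [n = 5], and otherwise
   [5 + 4 n] and [5 + n]. *)
pose b : seq int := if n == 5%N then [:: 1; 0] else [:: 1; 1 + n%:Z].
rewrite (@chi_periodic _ _ _ _ _ _ _ (@square_pt_inj R) _ n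
  [:: (0, 0); (1, 0)] (fun a : 'Z_2 => nth 0 b a)) //.
- by case=> -[|[|]].
- rewrite -[X in map X]/(nth 0 b \o val) map_comp; set s := map val _.
  vm_compute in s; rewrite /s /= /b.
  by case: eqP => [//|_]; rewrite /= !inE; lia.
- move=> a /mapP[p]; rewrite !inE => /orP[] /eqP -> ->;
  rewrite -(big_map (fun d => val _) xpredT (nth 0 b)); set s := map _ _;
  vm_compute in s; rewrite /s !big_cons big_nil /= /b;
  (have [->//|n5] := eqVneq n 5%N);
  [ apply: (@neq0_modz_prime 5 n _ 4) => // |
    apply: (@neq0_modz_prime 5 n _ 1) => // ]; ring.
Qed.

Lemma chi_hexagon (R : realType) (n : nat) : (2 <= n)%N -> chi (R6 R) n = 2%N.
Proof.
move=> n2; rewrite /R6 hexagon_tilingE.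
(* Index 0 is the class of the centers; the vertices carry the entries 1 and 2. All three neighbors
   lie in the other vertex class: the sums are 13 and 7 for [n = 3], and otherwise 1 and 3. *)
pose b : seq int := if n == 3%N then [:: 0; 1; 4] else [:: 0; 1; 0].
rewrite (@chi_periodic _ _ _ _ _ _ _ (@triangular_pt_inj R) _ n
  [:: (1, 0); (0, 1)] (fun a : 'Z_3 => nth 0 b a)) //.
- by case=> -[|[|[|]]].
- rewrite -[X in map X]/(nth 0 b \o val) map_comp; set s := map val _.
  vm_compute in s; rewrite /s /= /b.
  by case: eqP.
- move=> a /mapP[p]; rewrite !inE => /orP[] /eqP -> ->;
  rewrite -(big_map (fun d => val _) xpredT (nth 0 b)); set s := map _ _;
  vm_compute in s; rewrite /s !big_cons big_nil /= /b;
  (have [->//|n3] := eqVneq n 3%N).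
    by rewrite eqz_mod_dvd; case: n n2 {b n3} => [|[]].
  exact: (@neq0_modz_prime 3 n _ 0).
Qed.

Local Close Scope ring_scope.
Local Close Scope classical_set_scope.

Theorem theorem4p8 (R : realType) (n : nat) (hn : 2 <= n) :
  chi (R3 R) n = 3 /\ chi (R4 R) n = 2 /\ chi (R6 R) n = 2.
Proof.
by split; [exact: chi_triangle | split; [exact: chi_square|exact: chi_hexagon]].
Qed.
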